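(* Let $d\ge 1$ be an integer, let $\lambda$ be the Lebesgue measure on $\mathbb{R}^d$, and let $C\subset\mathbb{R}^d$ be a compact set that is nowhere dense in $\mathbb{R}^d$ and satisfies $\lambda(C)>0$. Let $\mathcal{R}$ be the ring of sets generated by $$\mathcal{C}:=\{(C+x)\cap I:\ x\in\mathbb{R}^d,\ I\subset\mathbb{R}^d\text{ is a box}\},$$ for every $E\subset\mathbb{R}^d$ put $$\mu^*(E):=\inf\Big\{\sum_{j=1}^\infty \lambda(R_j):\ E\subset\bigcup_{j\in\mathbb{N}}R_j,\ R_j\in\mathcal{R}\Big\}$$ (with $\inf\emptyset=+\infty$), and let $\mu$ be the restriction of $\mu^*$ to the Borel $\sigma$-algebra $\mathcal{B}(\mathbb{R}^d)$. Then $\mu$ is a translation invariant measure on $(\mathbb{R}^d,\mathcal{B}(\mathbb{R}^d))$ that is not a Hausdorff measure (that is, there is no right-continuous increasing $h:[0,\infty)\to[0,\infty]$ with $h(0)=0$ such that $\mu$ coincides on $\mathcal{B}(\mathbb{R}^d)$ with the Hausdorff measure corresponding to $h$), and whose range $\{\mu(B): B\in\mathcal{B}(\mathbb{R}^d)\}$ is equal to $[0,\infty]$.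
   Context: A box in $\mathbb{R}^d$ is a set $I=I_1\times\dots\times I_d$ where each $I_j$ is an interval in $\mathbb{R}$ (intervals may be open or closed, and they can be bounded or unbounded). A collection of sets is a ring if it is closed under set differences and finite unions; the ring generated by a collection is the smallest ring containing it. A measure $\mu$ on $\mathcal{B}(\mathbb{R}^d)$ is translation invariant if $\mu(B+x)=\mu(B)$ for all Borel $B$ and $x\in\mathbb{R}^d$. For $A\subset\mathbb{R}^d$, $\operatorname{diam}(A):=\sup_{x,y\in A}|x-y|$, with $\operatorname{diam}(\emptyset)=0$. Given a right-continuous increasing function $h:[0,\infty)\to[0,\infty]$ with $h(0)=0$, define for $E\subset\mathbb{R}^d$ $$\nu^*_\delta(E):=\inf\Big\{\sum_{j=1}^\infty h(\operatorname{diam}(E_j)):\ E\subset\bigcup_{j\in\mathbb{N}}E_j,\ \operatorname{diam}(E_j)<\delta\Big\},\qquad \nu^*(E):=\sup_{\delta>0}\nu^*_\delta(E).$$ The Hausdorff measure corresponding to $h$ is the restriction of the outer measure $\nu^*$ to its measurable sets (which include the Borel sets). *)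

(* Defs.v *)
From mathcomp Require Import all_boot all_order all_algebra.
From mathcomp Require Import all_classical all_reals all_analysis.
Set Implicit Arguments.
Unset Strict Implicit.
Unset Printing Implicit Defensive.
Import Order.TTheory GRing.Theory Num.Theory numFieldNormedType.Exports.
Local Open Scope classical_set_scope.
Local Open Scope ring_scope.
Local Open Scope ereal_scope.

Notation borel R d := (g_sigma_algebraType (@open 'rV[R]_d)).

Section defs.
Context {R : realType} {d : nat}.
Local Notation V := 'rV[R]_d.
Implicit Types (A B C E : set V) (x y a b : V).

Definition translate x A : set V := [set (a + x)%R | a in A].

(* [interval R] contains all intervals of R: open, closed or half-open,
   bounded or unbounded, possibly degenerate or empty. *)
Definition box (I : 'I_d -> interval R) : set V :=
  [set x | forall j, x ord0 j \in I j].

Definition nowhere_dense A := interior (closure A) = set0.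

(* Lebesgue measure on R^d is the restriction of this outer measure to its
   measurable sets, which include the Borel sets: compact sets and members
   of [<<r cut_translates C >>] with C compact are Borel. *)
Definition lebesgue_outer E : \bar R :=
  ereal_inf [set z | exists a b : nat -> V,
    [/\ forall k j, (a k ord0 j <= b k ord0 j)%R,
        E `<=` \bigcup_k box (fun j => `]a k ord0 j, b k ord0 j]%R)
      & z = \sum_(0 <= k <oo)
              (\prod_(j < d) (b k ord0 j - a k ord0 j)%R)%R%:E]].

Definition cut_translates C : set (set V) :=
  [set A | exists x I, A = translate x C `&` box I].

Definition mu_star C E : \bar R :=
  ereal_inf [set z | exists F : nat -> set V,
    [/\ forall j, <<r cut_translates C >> (F j),
        E `<=` \bigcup_j F j
      & z = \sum_(0 <= j <oo) lebesgue_outer (F j)]].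

(* The library norm on matrices is the maximum norm. *)
Definition euclidean_norm x : R := Num.sqrt (\sum_(j < d) x ord0 j ^+ 2)%R.

Definition diam A : \bar R :=
  if A == set0 then 0
  else ereal_sup [set z | exists x y,
         [/\ A x, A y & z = (euclidean_norm (x - y)%R)%:E]].

(* A function [0, oo) -> [0, oo] is encoded as a function R -> \bar R whose
   values at negative reals are irrelevant. *)
Definition hausdorff_gauge (h : R -> \bar R) :=
  [/\ forall t, (0 <= t)%R -> 0 <= h t,
      forall s t, (0 <= s)%R -> (s <= t)%R -> h s <= h t,
      forall t, (0 <= t)%R -> h s @[s --> t^'+] --> h t
    & h 0%R = 0].

(* [fine] is harmless: diam (F j) < delta makes diam (F j) a real number. *)
Definition hausdorff_pre (h : R -> \bar R) (delta : R) E : \bar R :=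
  ereal_inf [set z | exists F : nat -> set V,
    [/\ E `<=` \bigcup_j F j,
        forall j, diam (F j) < delta%:E
      & z = \sum_(0 <= j <oo) h (fine (diam (F j)))]].

(* The Hausdorff measure corresponding to h is the restriction of this outer
   measure to its measurable sets, which include the Borel sets. *)
Definition hausdorff_outer (h : R -> \bar R) E : \bar R :=
  ereal_sup [set hausdorff_pre h delta E | delta in [set r | (0 < r)%R]].

Definition translation_invariant (mu : set (borel R d) -> \bar R) :=
  forall (B : set (borel R d)) (x : V),
    measurable B -> mu (translate x B) = mu B.

Definition is_hausdorff_measure (mu : set (borel R d) -> \bar R) :=
  exists2 h, hausdorff_gauge h &
    forall B : set (borel R d), measurable B -> mu B = hausdorff_outer h B.

End defs.

(* Main.v *)
(* The Lebesgue outer measure and mu_star C are both infima of costs of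
   countable covers. Half-spaces split every member of the covering family
   without loss (for mu_star C because the ring is stable under intersection
   with boxes), so they, and hence all Borel sets, are Caratheodory
   measurable. On the ring mu_star C is the Lebesgue measure: cutting a
   finite union of disjoint translates of C by a moving half-space realises
   every value in [0, oo) by continuity. Members of the ring are nowhere
   dense, so by Baire a nonempty open set has no countable cover and mu is
   infinite on it. If mu were the Hausdorff measure of h, then either h t /
   t^d stays bounded along some t -> 0, and subdividing a cube into about
   t^-d cells shows that the cube has finite measure, or h t >= 2 (3 t)^d
   for small t, and since lambda E <= (3 diam E)^d this gives mu C >= 2
   lambda C; both are absurd. *)
From HB Require Import structures.
Require Import Defs.
From mathcomp Require Import all_boot all_order all_algebra lra ring.
From mathcomp Require Import all_classical all_reals all_analysis.
Set Implicit Arguments.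
Unset Strict Implicit.
Unset Printing Implicit Defensive.
Import Order.TTheory GRing.Theory Num.Theory numFieldNormedType.Exports.
Local Open Scope classical_set_scope.
Local Open Scope ring_scope.
Local Open Scope ereal_scope.

(** * Outer measures as infima of costs of countable covers *)

Section cover_outer.
Context {R : realType} {T J : Type}.
Variables (D : set J) (S : J -> set T) (w : J -> \bar R).
Hypothesis w_ge0 : forall j, D j -> 0 <= w j.

(** The weight sits on indices instead of sets, so that one construction serves both endpoint pairs
    weighted by volume and ring members weighted by [lebesgue_outer]. *)
Definition cover_outer (E : set T) : \bar R :=
  ereal_inf [set z | exists f : nat -> J,
    [/\ forall k, D (f k), E `<=` \bigcup_k S (f k)
      & z = \sum_(0 <= k <oo) w (f k)]].

Lemma cover_outer_ge0 E : 0 <= cover_outer E.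
Proof.
by apply: le_ereal_inf_tmp => _ [f [Df _ ->]]; apply: nneseries_ge0 => k _ _;
  apply: w_ge0.
Qed.

Lemma le_cover_outer : {homo cover_outer : A B / A `<=` B >-> A <= B}.
Proof.
move=> A B AB; apply: ereal_inf_le_tmp => z [f [Df Bf zE]].
by exists f; split=> //; apply: subset_trans Bf.
Qed.

Lemma cover_outer0 j0 : D j0 -> w j0 = 0 -> cover_outer set0 = 0.
Proof.
move=> Dj0 w0; apply/eqP; rewrite eq_le cover_outer_ge0 andbT.
apply: ereal_inf_lbound; exists (fun=> j0); split=> //.
by rewrite eseries0.
Qed.

(** The one-set cover is padded to a sequence with the weightless index [j0]. *)
Lemma cover_outer_le j0 j : D j0 -> w j0 = 0 -> D j -> cover_outer (S j) <= w j.
Proof.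
move=> Dj0 w0 Dj; apply: ereal_inf_lbound.
exists (fun k => if k is 0%N then j else j0); split.
- by case.
- by move=> t St; exists 0%N.
- rewrite nneseries_recl//; last by case=> [|k] _; apply: w_ge0.
  by rewrite eseries_cond/= eseries0 ?adde0// => -[].
Qed.

(** Covers of the [A n] that are optimal up to [e / 2 ^ n.+1] are merged into one sequence along a
    bijection of [nat] with [nat * nat]. Such covers are available only for finite values, hence the
    separate infinite case. *)
Lemma cover_outer_sigma_subadditive : sigma_subadditive cover_outer.
Proof.
move=> A; have [[i ioo]|] := pselect (exists i, cover_outer (A i) = +oo).
  by rewrite (eseries_pinfty _ _ ioo) ?leey// => n _;
    rewrite gt_eqF// (lt_le_trans _ (cover_outer_ge0 _)).
rewrite -forallNE => Aoo.
apply/lee_addgt0Pr => e e0.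
apply: le_trans (epsilon_trick xpredT (fun n => cover_outer_ge0 (A n)) (ltW e0)).
have cov n : exists g : nat -> J,
  [/\ forall k, D (g k), A n `<=` \bigcup_k S (g k) &
    \sum_(0 <= k <oo) w (g k) <= cover_outer (A n) + (e / (2 ^ n.+1)%:R)%:E].
  have en : (0 < e / (2 ^ n.+1)%:R)%R by rewrite divr_gt0// ltr0n expn_gt0.
  have finA : cover_outer (A n) \is a fin_num.
    by rewrite ge0_fin_numE ?cover_outer_ge0// ltey; apply/eqP.
  have [_ [f [Df Af ->]] /ltW fle] := lb_ereal_inf_adherent en finA.
  by exists f.
have [G PG] := choice cov.
have /card_esym/ppcard_eqP[f] := card_nat2.
apply: (@le_trans _ _ (\sum_(0 <= n <oo) \sum_(0 <= k <oo) w (G n k))); last first.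
  apply: lee_nneseries => [n _ _|n _]; last by case: (PG n).
  by apply: nneseries_ge0 => k _ _; apply: w_ge0; case: (PG n).
have w0 n k : 0 <= w (G n k) by apply: w_ge0; case: (PG n).
apply: ereal_inf_lbound; exists (fun k => G (f k).1 (f k).2); split.
- by move=> k; case: (PG (f k).1).
- move=> t [n _ Ant]; have [_ /(_ _ Ant)[k _ Skt] _] := PG n.
  by exists (f^-1%FUN (n, k)) => //; rewrite invK ?inE.
- have sw0 n : 0 <= \sum_(0 <= k <oo) w (G n k).
    by apply: nneseries_ge0 => k _ _.
  rewrite nneseries_esumT// nneseries_esumT//.
  transitivity (\esum_(i in [set: nat]) \esum_(k in [set: nat]) w (G i k)).
    by apply: eq_esum => n _; rewrite nneseries_esumT.
  rewrite esum_esum// (_ : _ `*`` _ = [set: nat * nat]); last first.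
    by apply/seteqP; split.
  exact: (reindex_esum [set: nat] [set: nat * nat] f (fun p => w (G p.1 p.2))).
Qed.

(** This reduces the Caratheodory inequality to single covering sets: cutting every member of a
    cover of [X] by [A] yields covers of both parts at no larger total cost. *)
Lemma cover_outer_split A :
  (forall j, D j -> exists j1 j2, [/\ D j1, D j2, S j `&` A `<=` S j1,
     S j `&` ~` A `<=` S j2 & w j1 + w j2 <= w j]) ->
  forall X, cover_outer (X `&` A) + cover_outer (X `&` ~` A) <= cover_outer X.
Proof.
move=> spl X; apply: le_ereal_inf_tmp => _ [f [Df Xf ->]].
have splk k : exists j : J * J,
    [/\ D j.1, D j.2, S (f k) `&` A `<=` S j.1,
     S (f k) `&` ~` A `<=` S j.2 & w j.1 + w j.2 <= w (f k)].
  by have [j1 [j2 ?]] := spl _ (Df k); exists (j1, j2).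
have [g gP] := choice splk.
apply: (@le_trans _ _ (\sum_(0 <= k <oo) (w (g k).1 + w (g k).2))).
  rewrite nneseriesD; last 2 first.
  - by move=> k _ _; apply: w_ge0; case: (gP k).
  - by move=> k _ _; apply: w_ge0; case: (gP k).
  apply: leeD; apply: ereal_inf_lbound.
  - exists (fun k => (g k).1); split=> //; first by move=> k; case: (gP k).
    move=> x [/Xf[k _ fx] Ax]; exists k => //.
    by case: (gP k) => _ _ gA _ _; apply: gA.
  - exists (fun k => (g k).2); split=> //; first by move=> k; case: (gP k).
    move=> x [/Xf[k _ fx] Ax]; exists k => //.
    by case: (gP k) => _ _ _ gA _; apply: gA.
apply: lee_nneseries => [k _ _|k _]; last by case: (gP k).
by apply: adde_ge0; apply: w_ge0; case: (gP k).
Qed.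

End cover_outer.

(** * From Caratheodory measurable half-spaces to a Borel measure *)

Section borel_of_outer.
Context {R : realType} {d : nat}.
Local Notation V := 'rV[R]_d.

Definition halfspace (j : 'I_d) (t : R) : set V := [set x | (x ord0 j <= t)%R].

Section caratheodory.
Variable mu : {outer_measure set V -> \bar R}.
Hypothesis mu_halfspace : forall j t, mu.-caratheodory (halfspace j t).

Lemma box_caratheodory (a b : V) :
  mu.-caratheodory (box (fun j => `]a ord0 j, b ord0 j])).
Proof.
rewrite (_ : box _ = \big[setI/setT]_(j <- index_enum 'I_d)
    (~` halfspace j (a ord0 j) `&` halfspace j (b ord0 j))).
  elim/big_ind : _ => //.
  - rewrite -setC0; apply: caratheodory_measurable_setC.
    exact: caratheodory_measurable_set0.
  - by move=> A B; apply: caratheodory_measurable_setI.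
  - move=> j _; apply: caratheodory_measurable_setI => //.
    exact: caratheodory_measurable_setC.
rewrite -bigcap_seq; apply/seteqP; split=> x /= bx j.
- move=> _; have := bx j; rewrite in_itv/= => /andP[ax xb]; split=> //.
  by apply/negP; rewrite -ltNge.
- have [|/negP ax xb] := bx j; first by rewrite /= mem_index_enum.
  by rewrite in_itv/= ltNge ax.
Qed.

(** [U] is the countable union of the half-open boxes with rational corners that it contains. *)
Lemma open_caratheodory (U : set V) : open U -> mu.-caratheodory U.
Proof.
move=> oU; pose Q := ('rV[rat]_d * 'rV[rat]_d)%type.
pose cell (q : Q) : set V :=
  box (fun j => `]ratr (q.1 ord0 j), ratr (q.2 ord0 j)]).
(* Numbers that code no pair, or a box not inside [U], contribute the empty set. *)
pose F k := if unpickle k is Some q then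
  (if `[< cell q `<=` U >] then cell q else set0) else set0.
rewrite (_ : U = \bigcup_k F k).
  apply: caratheodory_measurable_bigcup => k; rewrite /F.
  have m0 : mu.-caratheodory set0 by exact: caratheodory_measurable_set0.
  case: unpickle => [q|//]; case: ifPn => // _.
  have := box_caratheodory (map_mx ratr q.1) (map_mx ratr q.2).
  by congr caratheodory_measurable; apply/seteqP; split=> x bx j; have := bx j;
    rewrite !mxE.
apply/seteqP; split=> [x Ux|x [k _]]; last first.
  by rewrite /F; case: unpickle => // q; case: asboolP => // + cx; apply.
have /nbhs_ballP[e /= e0 eU] : nbhs x U by exact: open_nbhs_nbhs.
(* Corners within [e] of [x] in each coordinate keep the box inside the ball, as the norm is the
   maximum norm. *)
have ratl j : exists q : rat, (x ord0 j - e < ratr q < x ord0 j)%R.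
  have [|q] := @rat_in_itvoo R (x ord0 j - e)%R (x ord0 j); first lra.
  by rewrite in_itv/= => ?; exists q.
have ratu j : exists q : rat, (x ord0 j < ratr q < x ord0 j + e)%R.
  have [|q] := @rat_in_itvoo R (x ord0 j)%R (x ord0 j + e)%R; first lra.
  by rewrite in_itv/= => ?; exists q.
have [a aP] := choice ratl; have [b bP] := choice ratu.
pose q : Q := (\row_j a j, \row_j b j).
exists (pickle q) => //; rewrite /F pickleK; case: asboolP => [_ j|[]].
  by rewrite in_itv/= !mxE; case/andP: (aP j) => _ ->; case/andP: (bP j) => /ltW ->.
move=> y qy; apply: eU; split=> // i j; rewrite (ord1 i) /ball/=.
have := qy j; rewrite in_itv/= !mxE => /andP[ay yb].
by have /andP[a1 a2] := aP j; have /andP[b1 b2] := bP j; rewrite ltr_norml; lra.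
Qed.

Lemma borel_caratheodory (B : set (borel R d)) :
  measurable B -> mu.-caratheodory B.
Proof.
apply: smallest_sub; last exact: open_caratheodory.
split=> [|A mA|F mF].
- exact: caratheodory_measurable_set0.
- by rewrite setTD; exact: caratheodory_measurable_setC.
- exact: caratheodory_measurable_bigcup.
Qed.

Lemma outer_measure_borel :
  exists m : {measure set (borel R d) -> \bar R}, forall B, m B = mu B.
Proof.
pose f : set (borel R d) -> \bar R := mu.
have fsa : semi_sigma_additive f.
  move=> F mF tF mUF.
  apply: (caratheodory_measure_sigma_additive (mu := mu)) => //.
    by move=> i; exact: borel_caratheodory.
  exact: borel_caratheodory.
by exists (HB.pack_for {measure set (borel R d) -> \bar R} f
  (isMeasure.Build _ _ _ f (outer_measure0 mu) (outer_measure_ge0 mu) fsa)).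
Qed.

End caratheodory.
End borel_of_outer.

(** * Lebesgue outer measure *)

Section lebesgue.
Context {R : realType} {n : nat}.
Local Notation d := n.+1.
Local Notation V := 'rV[R]_d.
Implicit Types (A B E : set V) (a b x : V).

Let ordered : set (V * V) := [set p : V * V | forall j, (p.1 ord0 j <= p.2 ord0 j)%R].
Let cell (p : V * V) : set V := box (fun j => `]p.1 ord0 j, p.2 ord0 j]).
Let vol (p : V * V) : \bar R := (\prod_(j < d) (p.2 ord0 j - p.1 ord0 j)%R)%R%:E.

Let lebesgue_outerE : @lebesgue_outer R d = cover_outer ordered cell vol.
Proof.
apply/funext => E; congr ereal_inf; apply/seteqP; split=> z /=.
  by move=> [a [b [ab Eab ->]]]; exists (fun k => (a k, b k)).
by move=> [f [fD Ef ->]]; exists (fun k => (f k).1), (fun k => (f k).2).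
Qed.

Let vol_ge0 p : ordered p -> 0 <= vol p.
Proof. by move=> op; rewrite lee_fin prodr_ge0// => j _; rewrite subr_ge0. Qed.

(** The weightless padding index; it relies on the dimension being positive, since an empty product
    would be 1. *)
Let vol0 : vol (0, 0)%R = 0.
Proof. by rewrite /vol (bigD1 ord0)//= subrr mul0r. Qed.

Let ordered0 : ordered (0, 0)%R. Proof. by []. Qed.

Let lebesgue_outer0 : @lebesgue_outer R d set0 = 0.
Proof. by rewrite lebesgue_outerE; apply: cover_outer0 vol0. Qed.

Let lebesgue_outer_ge0 E : 0 <= lebesgue_outer E.
Proof. by rewrite lebesgue_outerE; exact: cover_outer_ge0. Qed.

Let le_lebesgue_outer : {homo @lebesgue_outer R d : A B / A `<=` B >-> A <= B}.
Proof. by rewrite lebesgue_outerE; exact: le_cover_outer. Qed.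

Let lebesgue_outer_sigma_subadditive : sigma_subadditive (@lebesgue_outer R d).
Proof. by rewrite lebesgue_outerE; exact: cover_outer_sigma_subadditive. Qed.

HB.instance Definition _ := isOuterMeasure.Build R V (@lebesgue_outer R d)
  lebesgue_outer0 lebesgue_outer_ge0 le_lebesgue_outer
  lebesgue_outer_sigma_subadditive.

Lemma lebesgue_outer_le E a b : (forall j, (a ord0 j <= b ord0 j)%R) ->
  E `<=` box (fun j => `]a ord0 j, b ord0 j]) ->
  lebesgue_outer E <= (\prod_(j < d) (b ord0 j - a ord0 j)%R)%R%:E.
Proof.
move=> ab Eab; apply: le_trans (le_lebesgue_outer Eab) _.
rewrite lebesgue_outerE.
exact: (cover_outer_le cell vol_ge0 ordered0 vol0 (j := (a, b))).
Qed.

(** A half-space cuts a half-open box into two half-open boxes whose volumes add up. *)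
Lemma lebesgue_halfspace (j : 'I_d) (t : R) :
  (@lebesgue_outer R d).-caratheodory (halfspace j t).
Proof.
suff spl X : lebesgue_outer (X `&` halfspace j t) +
    lebesgue_outer (X `&` ~` halfspace j t) <= lebesgue_outer X.
  exact: le_caratheodory_measurable.
rewrite lebesgue_outerE; move: X; apply: cover_outer_split => // -[a b] /= ab.
(* The cut [t] is clamped to the [j]-th side, so both pieces stay ordered even when the hyperplane
   misses the box. *)
set m := Num.max (a ord0 j) (Num.min (b ord0 j) t).
have [am mb] : (a ord0 j <= m /\ m <= b ord0 j)%R.
  by rewrite /m le_max lexx/= ge_max ab ge_min lexx.
pose b1 : V := \row_i if i == j then m else b ord0 i.
pose a2 : V := \row_i if i == j then m else a ord0 i.
exists (a, b1), (a2, b); split.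
- by move=> i /=; rewrite mxE; case: eqP => [->|_].
- by move=> i /=; rewrite mxE; case: eqP => [->|_].
- move=> x [xab xt] i; have := xab i; rewrite /= !in_itv/= mxE.
  case: eqP => [->|//] /andP[-> xb].
  by rewrite /m le_max le_min xb xt orbT.
- move=> x [xab /negP]; rewrite -ltNge => xt i; have := xab i.
  rewrite /= !in_itv/= mxE.
  case: eqP => [->|//] /andP[xa ->]; rewrite andbT.
  by rewrite /m gt_max xa gt_min xt orbT.
(* Only factor [j] changes, and [(m - a) + (b - m) = b - a] there. *)
- rewrite /vol -EFinD lee_fin /= (bigD1 j)//= [X in (_ + X)%R](bigD1 j)//=.
  rewrite [in leRHS](bigD1 j)//= !mxE eqxx.
  under eq_bigr => i /negPf ij do rewrite mxE ij.
  under [X in (_ + _ * X)%R]eq_bigr => i /negPf ij do rewrite mxE ij.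
  by rewrite -mulrDl addrC addrA subrK.
Qed.

End lebesgue.

(** * Translations of sets, boxes and Lebesgue outer measure *)

Section translate.
Context {R : realType} {n : nat}.
Local Notation d := n.+1.
Local Notation V := 'rV[R]_d.
Implicit Types (A B C E : set V) (x y : V).

Lemma translateE x A : translate x A = [set y | A (y - x)%R].
Proof.
apply/seteqP; split=> [_ [y Ay <-]|y Ay] /=; first by rewrite addrK.
by exists (y - x)%R => //; rewrite subrK.
Qed.

Lemma translate0 A : translate 0%R A = A.
Proof. by rewrite translateE; apply/seteqP; split=> y /=; rewrite subr0. Qed.

Lemma translateD x y A : translate x (translate y A) = translate (x + y) A.
Proof.
by rewrite !translateE; apply/seteqP; split=> z /=; rewrite opprD addrA.
Qed.

Definition shift_bound (r : R) (b : itv_bound R) : itv_bound R :=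
  if b is BSide c t then BSide c (t + r)%R else b.

Definition shift_itv (r : R) (i : interval R) : interval R :=
  let: Interval l u := i in Interval (shift_bound r l) (shift_bound r u).

Lemma in_shift_itv r (i : interval R) t :
  (t \in shift_itv r i) = ((t - r)%R \in i).
Proof.
by case: i => [[[] l|[]] [[] u|[]]];
  rewrite !in_itv/= ?lerBrDr ?ltrBrDr ?lerBlDr ?ltrBlDr.
Qed.

Lemma translate_box x (I : 'I_d -> interval R) :
  translate x (box I) = box (fun j => shift_itv (x ord0 j) (I j)).
Proof.
by rewrite translateE; apply/seteqP; split=> y yI j; have := yI j;
  rewrite in_shift_itv !mxE.
Qed.

Lemma lebesgue_outer_translate x A :
  lebesgue_outer (translate x A) = lebesgue_outer A.
Proof.
(* Equality follows by applying the inequality to [x] and to its opposite. *)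
suff le y B : lebesgue_outer (translate y B) <= lebesgue_outer B.
  apply/eqP; rewrite eq_le le/=.
  by rewrite -[in leLHS](translate0 A) -(addNr x) -translateD le.
apply: le_ereal_inf_tmp => _ [a [b [ab Bab ->]]].
apply: ereal_inf_lbound; exists (fun k => a k + y)%R, (fun k => b k + y)%R; split.
- by move=> k j; rewrite !mxE lerD2r.
- move=> z; rewrite translateE => /= /Bab[k _ zk]; exists k => // j.
  by have := zk j; rewrite !in_itv/= !mxE ltrBrDr lerBlDr.
- apply: eq_eseriesr => k _; congr EFin; apply: eq_bigr => j _.
  by rewrite !mxE; ring.
Qed.

End translate.

Lemma shift_continuous (K : numFieldType) (W : normedModType K) (x : W) :
  continuous (fun y : W => y + x)%R.
Proof. by move=> y; apply: cvgD; [exact: cvg_id|exact: cvg_cst]. Qed.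

(** * The ring generated by the cut translates of [C] *)

Section ring_of_translates.
Context {R : realType} {n : nat}.
Local Notation d := n.+1.
Local Notation V := 'rV[R]_d.
Implicit Types (A B C E : set V) (x y : V).

Lemma closed_translate C x : closed C -> closed (translate x C).
Proof.
move=> clC; rewrite translateE.
by apply: (preimage_closed _ clC) => y _; exact: shift_continuous.
Qed.

(** The sets whose trace on [box I] is in the ring form a ring, and this ring contains the
    generators because two boxes meet in a box. *)
Lemma cut_ring_setI_box C A (I : 'I_d -> interval R) :
  <<r cut_translates C >> A -> <<r cut_translates C >> (A `&` box I).
Proof.
move: A; apply: smallest_sub; first split.
- by rewrite /= set0I.
- by move=> A B /= rA rB; rewrite setIUl; exact: setringU.
- move=> A B /= rA rB; rewrite (_ : _ `&` _ = (A `&` box I) `\` (B `&` box I)).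
    exact: setringD.
  by apply/seteqP; split=> x /= [[? ?] h]; split; tauto.
- move=> _ [x [J ->]]; apply: sub_setring.
  exists x, (fun j => J j `&` I j)%O; rewrite -setIA; congr setI.
  apply/seteqP; split=> y /=.
    by move=> [yJ yI] j; rewrite in_itvI yJ yI.
  by move=> yJI; split=> j; have := yJI j; rewrite in_itvI => /andP[].
Qed.

Lemma halfspaceE (j : 'I_d) (t : R) :
  halfspace j t = box (fun i => if i == j then `]-oo, t] else `]-oo, +oo[).
Proof.
apply/seteqP; split=> x /= => [xt i|/(_ j)]; last by rewrite eqxx in_itv.
by case: eqP => [->|_]; rewrite in_itv.
Qed.

Lemma cut_ring_translate_of C x : <<r cut_translates C >> (translate x C).
Proof.
apply: sub_setring; exists x, (fun=> `]-oo, +oo[); apply/esym/setIidPl.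
by move=> y _ j; rewrite in_itv.
Qed.

Lemma cut_ring_translate C A x :
  <<r cut_translates C >> A -> <<r cut_translates C >> (translate x A).
Proof.
move: A; apply: smallest_sub; first split; rewrite ?/=.
- by rewrite translateE; exact: setring0.
- move=> A B /=; rewrite !translateE => rA rB; exact: (setringU rA rB).
- move=> A B /=; rewrite !translateE => rA rB; exact: (setringD rA rB).
- move=> _ [y [I ->]] /=.
  have -> : translate x (translate y C `&` box I) =
      translate (x + y) C `&` translate x (box I).
    by rewrite -translateD !translateE.
  rewrite translate_box; apply: sub_setring.
  by exists (x + y)%R, (fun j => shift_itv (x ord0 j) (I j)).
Qed.

(** Nowhere density is put in the form that Baire's theorem consumes. A union avoids the
    intersection of the two dense open sets, a difference keeps that of its first term, and a
    generator avoids the complement of its translate of [C]. *)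
Lemma cut_ring_nowhere_dense C A : closed C -> nowhere_dense C ->
  <<r cut_translates C >> A ->
  exists G : set V, [/\ open G, dense G & A `&` G = set0].
Proof.
move=> clC ndC; move: A; apply: smallest_sub; first split.
- by exists setT; split; [exact: openT|move=> O ? _; rewrite setIT|rewrite set0I].
- move=> A B [G [oG dG AG]] [H [oH dH BH]]; exists (G `&` H); split.
  + exact: openI.
  + exact: denseI.
  + by rewrite setIUl setIA AG set0I set0U setICA BH setI0.
- move=> A B [G [oG dG AG]] _; exists G; split=> //.
  by rewrite -subset0 => x [[Ax _] Gx]; rewrite -AG.
- move=> _ [x [I ->]]; exists (~` translate x C); split.
  + by apply: closed_openC; exact: closed_translate.
  + move=> O [y Oy] oO; apply: contrapT => OC.
    (* An open set missing the complement of [translate x C] would, moved back by [x], be an open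
       subset of [C]. *)
    have shiftO : (fun z : V => z + x)%R @^-1` O `<=` C.
      move=> z Oz; apply: contrapT => Cz; apply: OC; exists (z + x)%R.
      by split=> //=; rewrite translateE /= addrK.
    have openO : open ((fun z : V => z + x)%R @^-1` O).
      by apply: open_comp => // z _; exact: shift_continuous.
    suff : interior (closure C) (y - x)%R by rewrite ndC.
    have /(_ (y - x)%R) : (fun z : V => z + x)%R @^-1` O `<=` interior (closure C).
      by rewrite -open_subsetE//; apply: subset_trans shiftO _; exact: subset_closure.
    by apply; rewrite /= subrK.
  + by rewrite -subset0 => y [[Cy _]] /=; apply.
Qed.

End ring_of_translates.

(* Matrices are complete and normed, but the join of the two structures, which
   Baire needs, is only found once completeness is declared at this instance. *)
HB.instance Definition _ (R : realType) (n : nat) :=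
  Uniform_isComplete.Build (matrix R 1 n) cauchy_cvg.

(** * The outer measure [mu_star C] *)

Section mu_star.
Context {R : realType} {n : nat}.
Local Notation d := n.+1.
Local Notation V := 'rV[R]_d.
Implicit Types (A B E : set V) (x y : V).
Variable C : set V.

Let mu_starE : mu_star C = cover_outer <<r cut_translates C >> id lebesgue_outer.
Proof. by []. Qed.

Let leb_ge0 A : <<r cut_translates C >> A -> 0 <= lebesgue_outer A.
Proof. by move=> _; exact: outer_measure_ge0. Qed.

Let leb0 : lebesgue_outer (set0 : set V) = 0.
Proof. exact: outer_measure0. Qed.

Let mu_star0 : mu_star C set0 = 0.
Proof. exact: (cover_outer0 id leb_ge0 (setring0 _) leb0). Qed.

Let mu_star_ge0 E : 0 <= mu_star C E.
Proof. exact: (cover_outer_ge0 id leb_ge0). Qed.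

Let le_mu_star : {homo mu_star C : A B / A `<=` B >-> A <= B}.
Proof. exact: (@le_cover_outer R V _ <<r cut_translates C >> id). Qed.

Let mu_star_sigma_subadditive : sigma_subadditive (mu_star C).
Proof. exact: (cover_outer_sigma_subadditive id leb_ge0). Qed.

HB.instance Definition _ := isOuterMeasure.Build R V (mu_star C)
  mu_star0 mu_star_ge0 le_mu_star mu_star_sigma_subadditive.

Lemma lebesgue_le_mu_star E : lebesgue_outer E <= mu_star C E.
Proof.
apply: le_ereal_inf_tmp => _ [F [_ EF ->]].
apply: le_trans (le_outer_measure (@lebesgue_outer R d) _ _ EF) _.
exact: outer_measure_sigma_subadditive.
Qed.

(** One bound is countable subadditivity of [lebesgue_outer]; the other comes from covering [A] by
    itself. *)
Lemma mu_star_cut_ring A :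
  <<r cut_translates C >> A -> mu_star C A = lebesgue_outer A.
Proof.
move=> rA; apply/eqP; rewrite eq_le lebesgue_le_mu_star andbT.
exact: (cover_outer_le id leb_ge0 (setring0 _) leb0 rA).
Qed.

Lemma mu_star_halfspace j t : (mu_star C).-caratheodory (halfspace j t).
Proof.
suff spl X : mu_star C (X `&` halfspace j t) +
    mu_star C (X `&` ~` halfspace j t) <= mu_star C X.
  exact: le_caratheodory_measurable.
rewrite mu_starE; move: X.
apply: (@cover_outer_split R V _ _ id _ leb_ge0) => A rA.
have rAH : <<r cut_translates C >> (A `&` halfspace j t).
  by rewrite halfspaceE; exact: cut_ring_setI_box.
(* The second piece is written as a difference of two ring members, so that it is visibly in the
   ring; the weights add up by [lebesgue_halfspace]. *)
exists (A `&` halfspace j t), (A `\` (A `&` halfspace j t)); split=> //.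
- exact: setringD.
- by move=> x [Ax Hx]; split=> // -[].
- by rewrite setDIr setDv set0U setDE -(lebesgue_halfspace j t A).
Qed.

Lemma mu_star_translate x A : mu_star C (translate x A) = mu_star C A.
Proof.
suff le y B : mu_star C (translate y B) <= mu_star C B.
  apply/eqP; rewrite eq_le le/=.
  by rewrite -[in leLHS](translate0 A) -(addNr x) -translateD le.
apply: le_ereal_inf_tmp => _ [F [rF BF ->]].
apply: ereal_inf_lbound; exists (fun k => translate y (F k)); split.
- by move=> k; exact: cut_ring_translate.
- move=> z; rewrite translateE => /BF[k _ Fz]; exists k => //.
  by rewrite translateE.
- by apply: eq_eseriesr => k _; rewrite lebesgue_outer_translate.
Qed.

Lemma mu_star_open (U : set V) : closed C -> nowhere_dense C ->
  open U -> U !=set0 -> mu_star C U = +oo.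
Proof.
move=> clC ndC oU U0; rewrite /mu_star (_ : [set z | _] = set0) ?ereal_inf0//.
rewrite -subset0 => z [F [rF UF _]].
have [G GP] := choice (fun k => cut_ring_nowhere_dense clC ndC (rF k)).
have dG : dense (\bigcap_k G k) by apply: Baire => k; have [] := GP k.
have [x [/UF[k _ Fx] Gx]] := dG _ U0 oU.
have [_ _ FG] := GP k.
have : (F k `&` G k) x by split=> //; exact: Gx.
by rewrite FG.
Qed.

End mu_star.

(** * Borel sets of any prescribed finite measure *)

Section cut.
Context {R : realType} {n : nat}.
Local Notation d := n.+1.
Local Notation V := 'rV[R]_d.
Implicit Types (A B C E : set V) (x y : V) (M : R).

Definition cube M : set V := [set x | forall j, (`|x ord0 j| < M)%R].

Lemma compact_sub_cube C : compact C -> exists2 M, (0 < M)%R & C `<=` cube M.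
Proof.
move=> /compact_bounded[M [Mreal CM]].
(* Boundedness gives a bound for numbers exceeding [M], such as [|M| + 1]; one more unit makes the
   inequality strict. *)
exists (`|M| + 2)%R; first by rewrite ltr_wpDl.
move=> x Cx j.
have xM : (`|x| <= `|M| + 1)%R.
  by apply: CM => //; rewrite (le_lt_trans (ler_norm M))// ltrDl.
have : ball (0%R : V) (`|M| + 2)%R x.
  by rewrite mx_norm_ball /ball_ /= sub0r normrN (le_lt_trans xM)// ltrD2l ltr1n.
by move=> [_ /(_ ord0 j)]; rewrite /ball/= mxE sub0r normrN.
Qed.

(** The points gained between [s] and [t] lie in a box of width [t - s] whose [n] other sides have
    length [2M]. *)
Lemma lebesgue_slab E M s t : E `<=` cube M -> (0 < M)%R -> (s <= t)%R ->
  lebesgue_outer (E `&` halfspace ord0 t) <=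
  lebesgue_outer (E `&` halfspace ord0 s) + ((t - s) * (M *+ 2) ^+ n)%:E.
Proof.
move=> EM M0 st.
pose slab := E `&` halfspace ord0 t `\` halfspace ord0 s.
have slab_le : lebesgue_outer slab <= ((t - s) * (M *+ 2) ^+ n)%:E.
  pose a : V := \row_j if j == ord0 then s else (- M)%R.
  pose b : V := \row_j if j == ord0 then t else M.
  apply: (@le_trans _ _ (\prod_(j < d) (b ord0 j - a ord0 j)%R)%R%:E).
    apply: lebesgue_outer_le => [j|x [[Ex xt] /negP]].
      by rewrite !mxE; case: ifP => // _; rewrite ge0_cp// ltW.
    rewrite -ltNge => xs j; rewrite in_itv/= !mxE.
    have := EM _ Ex j; rewrite ltr_norml => /andP[xM Mx].
    by case: eqP => [->|_]; [rewrite xs xt|rewrite xM ltW].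
  rewrite lee_fin big_ord_recl !mxE eqxx.
  under eq_bigr do rewrite !mxE/= opprK -mulr2n.
  by rewrite prodr_const card_ord.
have splitE : E `&` halfspace ord0 t `<=` (E `&` halfspace ord0 s) `|` slab.
  move=> x [Ex xt]; case: (pselect (halfspace ord0 s x)) => xs; first by left.
  by right.
apply: le_trans (le_outer_measure (@lebesgue_outer R d) _ _ splitE) _.
apply: le_trans (outer_measureU2 _ _ _) _.
by rewrite leeD2l.
Qed.

Lemma lebesgue_cube_lty E M : E `<=` cube M -> (0 < M)%R ->
  lebesgue_outer E < +oo.
Proof.
move=> EM M0.
have := @lebesgue_slab E M (- M)%R M EM M0.
rewrite (_ : E `&` halfspace _ M = E); last first.
  apply/setIidPl => x /EM /(_ ord0); rewrite ltr_norml => /andP[_ /ltW]; exact.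
rewrite (_ : E `&` halfspace _ (- M)%R = set0); last first.
  rewrite -subset0 => x [/EM /(_ ord0)]; rewrite ltr_norml => /andP[Mx _].
  by rewrite /halfspace/= leNgt Mx.
rewrite outer_measure0 add0e => /(_ _)/le_lt_trans; apply; rewrite ?ltry//.
by rewrite ge0_cp// ltW.
Qed.

(** As a function of [t] the measure is Lipschitz by [lebesgue_slab], vanishes at [-M] and is that
    of [E] at [M]; the intermediate value theorem applies. *)
Lemma lebesgue_cut E M z : E `<=` cube M -> (0 < M)%R ->
  0 <= z -> z <= lebesgue_outer E ->
  exists t, lebesgue_outer (E `&` halfspace ord0 t) = z.
Proof.
move=> EM M0 z0 zE.
pose f t := fine (lebesgue_outer (E `&` halfspace ord0 t)).
have finE t : lebesgue_outer (E `&` halfspace ord0 t) \is a fin_num.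
  rewrite ge0_fin_numE; last exact: outer_measure_ge0.
  by apply: (@lebesgue_cube_lty _ M) => // x [/EM].
have fE t : (f t)%:E = lebesgue_outer (E `&` halfspace ord0 t) by rewrite fineK.
have fM : (f M)%:E = lebesgue_outer E.
  rewrite fE (_ : E `&` halfspace _ M = E)//.
  apply/setIidPl => x /EM /(_ ord0); rewrite ltr_norml => /andP[_ /ltW]; exact.
have fNM : f (- M)%R = 0%R.
  rewrite /f (_ : E `&` halfspace _ (- M)%R = set0) ?outer_measure0//.
  rewrite -subset0 => x [/EM /(_ ord0)]; rewrite ltr_norml => /andP[Mx _].
  by rewrite /halfspace/= leNgt Mx.
pose K := ((M *+ 2) ^+ n)%R.
have K0 : (0 < K)%R by rewrite exprn_gt0// mulrn_wgt0.
have lip s t : (s <= t)%R -> (`|f t - f s| <= (t - s) * K)%R.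
  move=> st; rewrite ger0_norm ?subr_ge0.
    by rewrite lerBlDl -lee_fin EFinD !fE; exact: lebesgue_slab.
  rewrite -lee_fin !fE; apply: (le_outer_measure (@lebesgue_outer R d)) => x [Ex xs].
  by split=> //; exact: le_trans st.
have cf : continuous f.
  move=> x; apply/cvgrPdist_le => e e0; near=> t.
  have xt : (`|x - t| * K <= e)%R.
    rewrite -ler_pdivlMr//; near: t; apply: cvgr_dist_le; first exact: cvg_id.
    exact: divr_gt0.
  apply: le_trans xt; case: (leP t x) => [tx|/ltW xt].
    by rewrite (ger0_norm (_ : 0 <= x - t)%R) ?subr_ge0// lip.
  by rewrite distrC [X in (_ <= X * _)%R]distrC
    (ger0_norm (_ : 0 <= t - x)%R) ?subr_ge0// lip.
have zfin : z \is a fin_num.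
  by rewrite ge0_fin_numE// (le_lt_trans zE)// -fM ltry.
have [|||t _ ft] := @IVT R f (- M)%R M (fine z).
- by rewrite ge0_cp// ltW.
- by apply: continuous_subspaceT => x; exact: cf.
- have f0 : (0 <= fine z)%R by exact: fine_ge0.
  have fz : (fine z <= f M)%R by rewrite -lee_fin fM fineK.
  by rewrite fNM ge_min f0 le_max fz orbT.
by exists t; rewrite -fE ft fineK.
Unshelve. all: by end_near. Qed.

(** Shifts along the first axis by multiples of the side [2M] of [cube M], which keep translates of
    its subsets disjoint. *)
Definition step (M : R) (k : nat) : V :=
  (\row_j if j == ord0 then (M *+ 2) *+ k else 0)%R.

Lemma lebesgue_big_translates C M N : C `<=` cube M -> (0 < M)%R ->
  N%:R%:E * lebesgue_outer C <=
  lebesgue_outer (\big[setU/set0]_(k < N) translate (step M k) C).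
Proof.
move=> CM M0; elim: N => [|N IH]; first by rewrite mul0e; exact: outer_measure_ge0.
have C0 k x : translate (step M k) C x ->
    ((M *+ 2) *+ k - M < x ord0 ord0 < (M *+ 2) *+ k + M)%R.
  rewrite translateE => /CM /(_ ord0); rewrite !mxE eqxx ltr_norml; lra.
set D := (X in _ <= _ X).
(* This hyperplane separates the last translate from the earlier ones, whose first coordinates stay
   below [2Mk + M] with [k < N]. *)
rewrite (lebesgue_halfspace ord0 ((M *+ 2) *+ N - M)%R D).
rewrite -natr1 EFinD ge0_muleDl ?lee_fin// mul1e; apply: leeD.
  apply: le_trans IH _; apply: (le_outer_measure (@lebesgue_outer R d)).
  rewrite /D big_ord_recr/= => x Dx; split; first by left.
  move: Dx.
  rewrite -(bigcup_mkord N (fun k => translate (step M k) C)).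
  move=> -[k /= kN /C0 /andP[_ /ltW xk]].
  apply: le_trans xk _; rewrite lerBrDr -addrA -mulr2n -mulrSr.
  by rewrite ler_pMn2l// mulrn_wgt0.
rewrite -(lebesgue_outer_translate (step M N) C).
apply: (le_outer_measure (@lebesgue_outer R d)) => x Cx; split.
  by rewrite /D big_ord_recr/=; right.
by rewrite /halfspace/=; have /andP[+ _] := C0 _ _ Cx; rewrite ltNge => /negP.
Qed.

Lemma closed_measurable A : closed A -> measurable (A : set (borel R d)).
Proof.
move=> clA; rewrite -(setCK A); apply: measurableC.
by apply: sub_sigma_algebra; exact: closed_openC.
Qed.

Lemma mu_star_onto C (r : R) : compact C -> 0 < lebesgue_outer C -> (0 <= r)%R ->
  exists2 B : set (borel R d), measurable B & mu_star C B = r%:E.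
Proof.
move=> cC C0 r0; have [M M0 CM] := compact_sub_cube cC.
pose D N := \big[setU/set0]_(k < N) translate (step M k) C.
have rD N : <<r cut_translates C >> (D N).
  rewrite /D; elim/big_ind : _ => //; first exact: setringU.
  by move=> k _; exact: cut_ring_translate_of.
have clC : closed C by apply: compact_closed => //; exact: norm_hausdorff.
have mD N : measurable (D N : set (borel R d)).
  apply: bigsetU_measurable => k _; apply: closed_measurable; exact: closed_translate.
have mH t : measurable (halfspace ord0 t : set (borel R d)).
  apply: closed_measurable.
  apply: (@preimage_closed _ _ (fun x : V => x ord0 ord0) [set y | y <= t]%R).
    by move=> x _; exact: coord_continuous.
  exact: closed_le.
have Cfin : lebesgue_outer C \is a fin_num.
  by rewrite ge0_fin_numE ?(ltW C0)//; exact: lebesgue_cube_lty CM M0.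
have c0 : (0 < fine (lebesgue_outer C))%R by rewrite fine_gt0// C0 ltey_eq Cfin.
(* Enough translates for their union to have measure at least [r]; a half-space then cuts it down to
   exactly [r]. *)
pose N := Num.Def.archi_bound (r / fine (lebesgue_outer C)).
have rN : r%:E <= lebesgue_outer (D N).
  apply: le_trans (lebesgue_big_translates N CM M0).
  rewrite -(fineK Cfin) -EFinM lee_fin -ler_pdivrMr//.
  by rewrite ltW// archi_boundP// divr_ge0// ltW.
have [M' M'0 DM'] : exists2 M', (0 < M')%R & D N `<=` cube M'.
  exists (M *+ 2 *+ N + M)%R; first by rewrite ltr_wpDl// !mulrn_wge0// ltW.
  rewrite /D -(bigcup_mkord N (fun k => translate (step M k) C)) => x [k /= kN].
  rewrite translateE => /CM xM j.
  have := xM j; rewrite !mxE; case: eqP => _; rewrite ?subr0.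
    have : (M *+ 2 *+ k <= M *+ 2 *+ N)%R 
      by rewrite ler_wpMn2l ?(ltnW kN)// mulrn_wge0// ltW.
    have : (0 <= M *+ 2 *+ k)%R by rewrite !mulrn_wge0// ltW.
    by rewrite !ltr_norml; lra.
  by move=> xj; rewrite (lt_le_trans xj)// lerDr !mulrn_wge0// ltW.
have [t tr] := lebesgue_cut DM' M'0 (r0 : 0 <= r%:E) rN.
exists (D N `&` halfspace ord0 t); first exact: measurableI.
rewrite mu_star_cut_ring//; rewrite halfspaceE; exact: cut_ring_setI_box.
Qed.

End cut.

(** * Comparison with Hausdorff measures *)

Section hausdorff.
Context {R : realType} {n : nat}.
Local Notation d := n.+1.
Local Notation V := 'rV[R]_d.
Implicit Types (A B C E : set V) (x y : V) (h : R -> \bar R).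

Lemma coord_le_euclidean_norm x j : (`|x ord0 j| <= euclidean_norm x)%R.
Proof.
rewrite -sqrtr_sqr ler_sqrt; last by apply: sumr_ge0 => i _; exact: sqr_ge0.
by rewrite (bigD1 j)//= lerDl sumr_ge0// => i _; exact: sqr_ge0.
Qed.

(** The factor [d] replaces the sharp square root of [d], using [d <= d ^ 2]. *)
Lemma euclidean_norm_le x (c : R) : (forall j, `|x ord0 j| <= c)%R ->
  (euclidean_norm x <= d%:R * c)%R.
Proof.
move=> xc; have c0 : (0 <= c)%R := le_trans (normr_ge0 _) (xc ord0).
have dc0 : (0 <= d%:R * c)%R by rewrite mulr_ge0.
rewrite -[leRHS]ger0_norm// -sqrtr_sqr ler_sqrt ?sqr_ge0//.
apply: (@le_trans _ _ (\sum_(j < d) c ^+ 2)%R).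
  by apply: ler_sum => j _; rewrite -[leLHS]real_normK ?num_real// lerXn2r ?nnegrE.
rewrite sumr_const card_ord -[leLHS]mulr_natl exprMn.
apply: ler_wpM2r; first exact: sqr_ge0.
by rewrite expr2 ler_peMl// ler1n.
Qed.

Lemma diam_ge0 E : 0 <= diam E.
Proof.
rewrite /diam; case: eqP => // /eqP/set0P[x Ex].
apply: le_trans (ereal_sup_ubound _); last by exists x, x.
by rewrite lee_fin sqrtr_ge0.
Qed.

Lemma diam_le E (r : R) : (0 <= r)%R ->
  (forall x y, E x -> E y -> (euclidean_norm (x - y)%R <= r)%R) -> diam E <= r%:E.
Proof.
move=> r0 Er; rewrite /diam; case: eqP => _; first by rewrite lee_fin.
by apply: ge_ereal_sup => _ [x [y [Ex Ey ->]]]; rewrite lee_fin Er.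
Qed.

Lemma coord_le_diam E x y j : E x -> E y -> (`|x ord0 j - y ord0 j|%R)%:E <= diam E.
Proof.
move=> Ex Ey; rewrite /diam; case: eqP => [E0|_]; first by rewrite E0 in Ex.
apply: le_trans (ereal_sup_ubound _); last by exists x, y.
by have := coord_le_euclidean_norm (x - y)%R j; rewrite !mxE lee_fin.
Qed.

(** With [D] the diameter, [E] lies in a box around any of its points with sides [2D + e]. For
    [D > 0] the choice [e = D] gives [3D]; for [D = 0], [e] tends to 0. *)
Lemma lebesgue_outer_diam E : diam E \is a fin_num ->
  lebesgue_outer E <= ((3 * fine (diam E)) ^+ d)%R%:E.
Proof.
move=> finE; have [->|/set0P[x Ex]] := eqVneq E set0.
  by rewrite outer_measure0 lee_fin exprn_ge0// mulr_ge0// fine_ge0// diam_ge0.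
set D := fine (diam E); have D0 : (0 <= D)%R by rewrite fine_ge0// diam_ge0.
(* The slack e is needed because a half-open box of side 0 is empty. *)
have Ele e : (0 < e)%R -> lebesgue_outer E <= ((D *+ 2 + e) ^+ d)%R%:E.
  move=> e0; pose a : V := \row_j (x ord0 j - D - e)%R.
  pose b : V := \row_j (x ord0 j + D)%R.
  apply: (@le_trans _ _ (\prod_(j < d) (b ord0 j - a ord0 j)%R)%R%:E).
    apply: lebesgue_outer_le => [j|y Ey j]; rewrite ?in_itv/= !mxE; first lra.
    have := coord_le_diam j Ey Ex; rewrite -[diam E]fineK// lee_fin ler_norml.
    by rewrite -/D; lra.
  rewrite lee_fin (eq_bigr (fun=> (D *+ 2 + e)%R)); last by move=> j _; rewrite !mxE; ring.
  by rewrite prodr_const card_ord.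
have [D0'|D0'] := eqVneq D 0%R; last first.
  have Dp : (0 < D)%R by rewrite lt_neqAle eq_sym D0'.
  apply: le_trans (Ele _ Dp) _; rewrite lee_fin.
  by rewrite (_ : D *+ 2 + D = 3 * D)%R//; ring.
rewrite D0' mulr0 expr0n/=; apply/lee_addgt0Pr => e e0; rewrite add0e.
(* Being at most 1 ensures [e1 ^ d <= e1 <= e]. *)
pose e1 := Num.min e 1%R.
have e10 : (0 < e1)%R by rewrite lt_min e0 ltr01.
apply: le_trans (Ele _ e10) _; rewrite D0' mul0rn add0r lee_fin.
apply: (@le_trans _ _ e1); last by rewrite ge_min lexx.
by rewrite exprS ler_piMr ?exprn_ile1 ?(ltW e10)// ge_min lexx orbT.
Qed.

(** In a cover by sets of diameter below [delta], each term dominates [c] times the Lebesgue outer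
    measure of its set, by [lebesgue_outer_diam]; subadditivity concludes. *)
Lemma hausdorff_outer_ge h (c delta : R) E : hausdorff_gauge h ->
  (0 <= c)%R -> (0 < delta)%R ->
  (forall t, (0 < t < delta)%R -> (c * (3 * t) ^+ d)%R%:E <= h t) ->
  c%:E * lebesgue_outer E <= hausdorff_outer h E.
Proof.
move=> [h0 _ _ h00] c0 delta0 hc.
apply: (@le_trans _ _ (hausdorff_pre h delta E)); last first.
  by apply: ereal_sup_ubound; exists delta.
apply: le_ereal_inf_tmp => _ [F [EF Fdelta ->]].
have Ffin k : diam (F k) \is a fin_num.
  by rewrite ge0_fin_numE ?diam_ge0// (lt_trans (Fdelta k))// ltry.
have F0 k : (0 <= fine (diam (F k)))%R by rewrite fine_ge0// diam_ge0.
have leb0 k : 0 <= lebesgue_outer (F k) by exact: outer_measure_ge0.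
apply: (@le_trans _ _ (c%:E * \sum_(0 <= k <oo) lebesgue_outer (F k))).
  apply: lee_wpmul2l; first by rewrite lee_fin.
  apply: le_trans (le_outer_measure (@lebesgue_outer R d) _ _ EF) _.
  exact: outer_measure_sigma_subadditive.
rewrite -nneseriesZl//; apply: lee_nneseries => [k _ _|k _].
  by rewrite mule_ge0.
apply: (@le_trans _ _ (c%:E * ((3 * fine (diam (F k))) ^+ d)%R%:E)).
  by apply: lee_wpmul2l; [rewrite lee_fin|exact: lebesgue_outer_diam].
have [->|t0] := eqVneq (fine (diam (F k))) 0%R.
  by rewrite mulr0 expr0n/= mule0 h0.
rewrite -EFinM; apply: hc; rewrite lt_neqAle eq_sym t0 F0/=.
by rewrite -lte_fin fineK.
Qed.

(** The cube is cut into [N ^ d] cells of diameter at most [t], at total cost at most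
    [N ^ d * h t <= M * (N * t) ^ d]. The bound depends on neither [t] nor [delta]. *)
Lemma hausdorff_pre_cube_le h (M delta t : R) E : hausdorff_gauge h ->
  E `<=` cube 1%R -> (0 < t < delta)%R -> (t <= 1)%R ->
  h t <= (M * t ^+ d)%R%:E -> (0 <= M)%R ->
  hausdorff_pre h delta E <= (M * (d%:R *+ 2 + 1) ^+ d)%R%:E.
Proof.
move=> [h0 hmono _ h00] E1 /andP[t0 tdelta] t1 ht M0.
(* [N] exceeds [2d / t], so cells of side [2 / N] have diameter at most [t]; it does so by at most
   1, so [N * t <= 2d + t <= 2d + 1]. *)
pose m := Num.truncn (d%:R *+ 2 / t)%R; pose N := m.+1.
have q0 : (0 <= d%:R *+ 2 / t)%R by rewrite divr_ge0 ?mulrn_wge0// ltW.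
have /andP[mle ltm] : (m%:R <= d%:R *+ 2 / t < N%:R)%R by exact: truncn_itv.
have N0 : (0 < N%:R :> R)%R by rewrite ltr0n.
have Nt : (N%:R * t <= d%:R *+ 2 + 1)%R.
  have : (m%:R * t <= d%:R *+ 2)%R by rewrite -ler_pdivlMr.
  have -> : (N%:R = m%:R + 1 :> R)%R by rewrite natr1.
  by rewrite mulrDl mul1r; lra.
have tN : (d%:R * (2 / N%:R) <= t)%R.
  rewrite mulrA ler_pdivrMr//.
  by move: ltm; rewrite ltr_pdivrMr// => ?; lra.
pose I := {ffun 'I_d -> 'I_N}.
pose side (k : nat) : R := (k%:R * (2 / N%:R) - 1)%R.
have sideS k : side k.+1 = (side k + 2 / N%:R)%R.
  by rewrite /side -[k.+1%:R]natr1; ring.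
pose cell (i : I) : set V :=
  [set x | forall j, (side (i j) <= x ord0 j < side (i j).+1)%R].
have cell_diam i : diam (cell i) <= t%:E.
  apply: diam_le => [|x y xi yi]; first exact: ltW.
  apply: le_trans tN; apply: euclidean_norm_le => j; rewrite !mxE.
  have := xi j; have := yi j; rewrite sideS => yj xj.
  by rewrite ler_norml; lra.
(* Past the last cell the sequence is empty, at cost [h 0 = 0]. *)
pose F (k : nat) := nth set0 [seq cell i | i <- enum I] k.
pose c : \bar R := (M * t ^+ d)%R%:E.
have Fdiam k : diam (F k) <= t%:E.
  have [kI|kI] := ltnP k (size [seq cell i | i <- enum I]); last first.
    by rewrite /F nth_default// /diam eqxx lee_fin ltW.
  by have /mapP[i _ Fi] := mem_nth set0 kI; rewrite /F Fi.
have Ffin k : diam (F k) \is a fin_num.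
  by rewrite ge0_fin_numE ?diam_ge0// (le_lt_trans (Fdiam k))// ltry.
have hF k : h (fine (diam (F k))) <= c.
  apply: le_trans ht; apply: hmono; first by rewrite fine_ge0// diam_ge0.
  by rewrite -lee_fin fineK.
apply: (@le_trans _ _ (\sum_(0 <= k <oo) h (fine (diam (F k))))).
  apply: ereal_inf_lbound; exists F; split=> //; last first.
    by move=> k; apply: le_lt_trans (Fdiam k) _; rewrite lte_fin.
  move=> x /E1 x1.
  have idx j : exists i : 'I_N, (side i <= x ord0 j < side i.+1)%R.
    have := x1 j; rewrite ltr_norml => /andP[x1l x1u].
    (* The coordinate rescaled from [(-1, 1)] to [(0, N)]; its integer part is the cell index. *)
    pose u := ((x ord0 j + 1) * N%:R / 2)%R.
    have u0 : (0 <= u)%R by rewrite !mulr_ge0// ltW//; lra.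
    have /andP[ul uu] := truncn_itv u0.
    have uN : (Num.truncn u < N)%N.
      rewrite -(ltr_nat R); apply: le_lt_trans ul _.
      rewrite /u ltr_pdivrMr// mulrC ltr_pM2l//; lra.
    exists (Ordinal uN); rewrite /side/= lerBlDr ltrBrDr !mulrA.
    by rewrite ler_pdivrMr// ltr_pdivlMr// -ler_pdivlMr// -ltr_pdivrMr// ul uu.
  have [i iP] := choice idx.
  pose i' : I := [ffun j => i j].
  exists (index i' (enum I)) => //.
  rewrite /F (nth_map i') ?index_mem ?mem_enum// nth_index ?mem_enum// => j.
  by rewrite ffunE.
rewrite (nneseries_split _ #|I|); last by move=> k _; rewrite h0// fine_ge0// diam_ge0.
rewrite [X in _ + X]eseries0 ?adde0; last first.
  move=> k kI _; rewrite /F nth_default; first by rewrite /diam eqxx h00.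
  by rewrite size_map -cardE.
rewrite big_mkord add0n.
apply: (@le_trans _ _ (\sum_(k < #|I|) c)); first by apply: lee_sum.
rewrite sumEFin lee_fin sumr_const card_ffun !card_ord -[leLHS]mulr_natl natrX mulrCA.
by rewrite ler_wpM2l// -exprMn lerXn2r// nnegrE ?mulr_ge0 ?(ltW t0)//.
Qed.

Lemma not_hausdorff (mu : set (borel R d) -> \bar R) C :
  compact C -> 0 < lebesgue_outer C ->
  mu C <= lebesgue_outer C -> mu (ball 0%R 1%R : set V) = +oo ->
  ~ is_hausdorff_measure mu.
Proof.
move=> cC C0 muC muU [h hg hmu].
have [M M0 CM] := compact_sub_cube cC.
have mC : measurable (C : set (borel R d)).
  apply: closed_measurable; apply: compact_closed => //; exact: norm_hausdorff.
have mU : measurable ((ball 0%R 1%R : set V) : set (borel R d)).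
  by apply: sub_sigma_algebra; exact: ball_open.
have Cfin : lebesgue_outer C \is a fin_num.
  by rewrite ge0_fin_numE ?(ltW C0)//; exact: lebesgue_cube_lty CM M0.
(* The factor 2 makes the first case contradict [mu C <= lebesgue_outer C], a positive finite
   number. *)
have [[delta delta0 hdelta]|hno] := pselect (exists2 delta, (0 < delta)%R &
    forall t, (0 < t < delta)%R -> (2 * (3 * t) ^+ d)%R%:E <= h t).
  have := hausdorff_outer_ge C hg (ler0n R 2) delta0 hdelta.
  rewrite -hmu// => /le_trans/(_ muC).
  rewrite -(fineK Cfin) -EFinM lee_fin leNgt => /negP; apply.
  by move: C0; rewrite -(fineK Cfin) lte_fin => C0; lra.
have : hausdorff_outer h (ball 0%R 1%R : set V) <=
    (2 * 3 ^+ d * (d%:R *+ 2 + 1) ^+ d)%R%:E.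
  apply: ge_ereal_sup => _ [delta /= delta0 <-].
  have [t [t0 tdelta t1 ht]] : exists t, [/\ (0 < t)%R, (t < delta)%R, (t <= 1)%R
      & h t <= (2 * 3 ^+ d * t ^+ d)%R%:E].
    (* The minimum with 1 secures [t <= 1], which the cell count requires. *)
    apply: contrapT => hsmall; apply: hno; exists (Num.min delta 1%R).
      by rewrite lt_min delta0 ltr01.
    move=> t /andP[t0]; rewrite lt_min => /andP[tdelta t1].
    rewrite leNgt; apply/negP => ht; apply: hsmall; exists t; split=> //.
      exact: ltW.
    by rewrite -mulrA -exprMn ltW.
  apply: (@hausdorff_pre_cube_le h _ _ t) .
  - by [].
  - by move=> x [_ /(_ ord0)] xj j; have := xj j; rewrite /ball/= mxE sub0r normrN.
  - by rewrite t0.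
  - by [].
  - by [].
  - by rewrite mulr_ge0 ?exprn_ge0.
by rewrite -hmu// muU leye_eq.
Qed.

End hausdorff.

Theorem corollary2 (R : realType) (d : nat) (hd : (1 <= d)%N)
    (C : set 'rV[R]_d) (hcompact : compact C) (hnd : nowhere_dense C)
    (hpos : 0 < lebesgue_outer C) :
  exists mu : {measure set (borel R d) -> \bar R},
    [/\ forall B : set (borel R d), measurable B -> mu B = mu_star C B,
        translation_invariant mu,
        ~ is_hausdorff_measure mu
      & [set mu B | B in measurable] = [set z : \bar R | 0 <= z]].
Proof.
case: d hd C hcompact hnd hpos => [//|n] _ C cC ndC C0.
have [m mE] := outer_measure_borel (mu_star_halfspace C).
have rC : <<r cut_translates C >> C.
  by rewrite -[X in _ X](translate0 C); exact: cut_ring_translate_of.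
have mC : m C = lebesgue_outer C by rewrite mE; exact: mu_star_cut_ring.
have clC : closed C by apply: compact_closed => //; exact: norm_hausdorff.
have moo (U : set 'rV[R]_n.+1) x : open U -> U x -> m U = +oo.
  by move=> oU Ux; rewrite mE; apply: mu_star_open => //; exists x.
exists m; split.
- by move=> B _; exact: mE.
- by move=> B x _; rewrite !mE; exact: mu_star_translate.
- apply: (not_hausdorff cC C0); first by rewrite mC.
  by apply: (moo _ 0%R); [exact: ball_open|exact: ballxx].
(* Finite values come from [mu_star_onto], and the value [+oo] is taken on the whole space. *)
- apply/seteqP; split=> [_ [B _ <-]|[r|_|//]] /=; first exact: measure_ge0.
    rewrite lee_fin => r0; have [B mB Br] := mu_star_onto cC C0 r0.
    by exists B => //; rewrite mE.
  by exists setT => //; apply: (moo _ 0%R) => //; exact: openT.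
Qed.
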